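(* If $X$ is a homogeneous compactum, then $|X|\leq 2^{wt(X)\cdot\pi_\chi(X)}$.
   Context: A compactum is a compact Hausdorff space. A space $X$ is homogeneous if for all $x,y\in X$ there is a homeomorphism $h:X\to X$ with $h(x)=y$. The tightness $t(Y)$ of a space $Y$ is the least infinite cardinal $\kappa$ such that whenever $A\subseteq Y$ and $x\in\overline{A}$ there is $B\subseteq A$ with $|B|\leq\kappa$ and $x\in\overline{B}$. For a cardinal $\mu$ and $A\subseteq X$, the $\mu$-closure of $A$ is $cl_\mu A=\bigcup\{\overline{B}:B\subseteq A,\ |B|\leq\mu\}$. The weak tightness $wt(X)$ is the least infinite cardinal $\kappa$ for which there is a cover $\mathcal{C}$ of $X$ by subsets of $X$ such that $|\mathcal{C}|\leq 2^\kappa$ and for all $C\in\mathcal{C}$: (a) $t(C)\leq\kappa$ (subspace topology) and (b) $X=cl_{2^\kappa}C$. The $\pi$-character $\pi_\chi(X)$ is the least infinite cardinal $\kappa$ such that every point $x\in X$ has a local $\pi$-base of cardinality at most $\kappa$, i.e. a family of non-empty open sets such that every neighborhood of $x$ contains a member of the family. *)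

(* Defs.v *)
From mathcomp Require Import all_boot all_order.
From mathcomp Require Import all_classical topology.

Set Implicit Arguments.
Unset Strict Implicit.
Unset Printing Implicit Defensive.

Local Open Scope classical_set_scope.
Local Open Scope card_scope.

(* A cardinal is represented by a type, the type K standing for the cardinal
   of [set: K]: comparison of cardinals is #<=, the product of K and L is K * L
   and 2 to the power K is the powerset type [set K]. *)

Definition is_least_infinite (P : Type -> Prop) (K : Type) : Prop :=
  [/\ infinite_set [set: K], P K &
      forall L : Type, infinite_set [set: L] -> P L -> [set: K] #<= [set: L]].

(* The value nat is only used when no infinite K satisfies P; see
   [least_infiniteP]. *)
Definition least_infinite (P : Type -> Prop) : Type :=
  match pselect (exists K, is_least_infinite P K) with
  | left e => projT1 (cid e)
  | right _ => nat
  end.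

Lemma inj_card_leT (T U : Type) (f : T -> U) :
  injective f -> [set: T] #<= [set: U].
Proof.
move=> finj; apply: (@card_le_trans _ _ _ (f @` [set: T])).
  have : f @` [set: T] #= [set: T] by apply: inj_card_eq => x y _ _ /finj.
  by rewrite card_eq_le => /andP[].
exact: card_leT.
Qed.

Lemma card_le_family_min (I : Type) (pr : I -> Type) (i0 : I) :
  exists i, forall j, [set: pr i] #<= [set: pr j].
Proof.
pose good (S : set (forall i, pr i)) :=
  forall i x y, S x -> S y -> x i = y i -> x = y.
have [|A [gA maxA]] := @Zorn_bigcup _ good.
  move=> F Fg Ft i x y [S FS Sx] [S' FS' S'y].
  have [SS'|S'S] := Ft _ _ FS FS'.
    by apply: (Fg _ FS') => //; exact: SS'.
  by apply: (Fg _ FS) => //; exact: S'S.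
have [[i onto]|notonto] :=
    pselect (exists i, forall k : pr i, exists x, A x /\ x i = k).
  exists i => j.
  pose g k := projT1 (cid (onto k)).
  have gP k : A (g k) /\ g k i = k by rewrite /g; case: cid.
  apply: (@inj_card_leT _ _ (fun k => g k j)) => k k' /= gkk'.
  have [Ak <-] := gP k; have [Ak' <-] := gP k'.
  by rewrite (gA j _ _ Ak Ak' gkk').
have miss i : exists k : pr i, forall x, A x -> x i <> k.
  apply: contrapT => H; apply: notonto; exists i => k; apply: contrapT => H'.
  by apply: H; exists k => x Ax xk; apply: H'; exists x.
pose z i := projT1 (cid (miss i)).
have zP i x : A x -> x i <> z i by rewrite /z; case: cid => k /= kP; exact: kP.
exfalso; apply: (maxA (A `|` [set z])).
  split; first by move=> x; left.
  by move=> /(_ z (or_intror erefl)) /(zP i0); apply.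
move=> i x y [Ax|->] [Ay|->] // => [|/zP|/esym/zP].
- exact: gA.
- by move/(_ Ax).
- by move/(_ Ay).
Qed.

Lemma card_leT_total (T U : Type) :
  [set: T] #<= [set: U] \/ [set: U] #<= [set: T].
Proof.
have [[] leb] := card_le_family_min (fun b : bool => if b then T else U) true.
- by left; exact: (leb false).
- by right; exact: (leb true).
Qed.

(* The minimum is taken over subsets of a given K0, so as not to quantify over
   a family indexed by a larger universe. *)
Lemma least_infinite_exists (P : Type -> Prop) :
  (exists K : Type, infinite_set [set: K] /\ P K) ->
  exists K, is_least_infinite P K.
Proof.
move=> [K0 [infK0 PK0]].
pose Q (S : set K0) :=
  exists L : Type, [/\ infinite_set [set: L], P L & S #= [set: L]].
have Q0 : Q [set: K0] by exists K0; split => //; exact: card_eqxx.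
have [[S QS] minS] := card_le_family_min
  (fun S : {S : set K0 | Q S} => set_type (proj1_sig S)) (exist _ _ Q0).
have [K [infK PK SK]] := QS.
have KS : [set: K] #<= S by move: SK; rewrite card_eq_le => /andP[].
exists K; split=> // L infL PL.
have [K0L|/card_subP[S' S'L _]] := card_leT_total K0 L.
  exact: card_le_trans KS (card_le_trans (card_leT S) K0L).
have QS' : Q S' by exists L.
have /= SS' := minS (exist _ S' QS').
apply: card_le_trans KS _; move: SS'.
by rewrite (card_le_eql (card_setT S)) (card_le_eqr (card_setT S'))
  (card_le_eqr S'L).
Qed.

Lemma least_infiniteP (P : Type -> Prop) :
  (exists K : Type, infinite_set [set: K] /\ P K) ->
  is_least_infinite P (least_infinite P).
Proof.
move=> /least_infinite_exists ex; rewrite /least_infinite.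
by case: pselect => // e; case: cid.
Qed.

Definition has_tightness_le (Y : topologicalType) (K : Type) : Prop :=
  forall (A : set Y) (x : Y), closure A x ->
    exists B : set Y, [/\ B `<=` A, B #<= [set: K] & closure B x].

Definition tightness (Y : topologicalType) : Type :=
  least_infinite (has_tightness_le Y).

Definition cl_card (X : topologicalType) (M : Type) (A : set X) : set X :=
  \bigcup_(B in [set B : set X | B `<=` A /\ B #<= [set: M]]) closure B.

(* A set C coerces to the sigma type [set_type C], whose topology is the
   subspace topology; [subspace C] would instead isolate the points of the
   complement of C. *)
Definition has_weak_tightness_le (X : topologicalType) (K : Type) : Prop :=
  exists CC : set (set X),
    [/\ \bigcup_(C in CC) C = [set: X],
        CC #<= [set: set K] &
        forall C : set X, CC C ->
          [set: tightness (set_type C)] #<= [set: K] /\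
          cl_card (set K) C = [set: X]].

Definition weak_tightness (X : topologicalType) : Type :=
  least_infinite (has_weak_tightness_le X).

Definition local_pi_base (X : topologicalType) (x : X) (B : set (set X)) :=
  (forall U, B U -> open U /\ U !=set0) /\
  (forall V, nbhs x V -> exists2 U, B U & U `<=` V).

Definition has_pi_character_le (X : topologicalType) (K : Type) : Prop :=
  forall x : X, exists B : set (set X), local_pi_base x B /\ B #<= [set: K].

Definition pi_character (X : topologicalType) : Type :=
  least_infinite (has_pi_character_le X).

Definition homeomorphism (X Y : topologicalType) (h : X -> Y) : Prop :=
  continuous h /\
  exists g : Y -> X, [/\ cancel h g, cancel g h & continuous g].

Definition homogeneous (X : topologicalType) : Prop :=
  forall x y : X, exists h : X -> X, homeomorphism h /\ h x = y.

Lemma infinite_sum_nat (T : Type) : infinite_set [set: T + nat].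
Proof.
apply/infiniteP; apply: (@inj_card_leT nat (T + nat) inr); by move=> m n [].
Qed.

Lemma tightnessP (Y : topologicalType) :
  is_least_infinite (has_tightness_le Y) (tightness Y).
Proof.
apply: least_infiniteP; exists (Y + nat)%type; split.
  exact: infinite_sum_nat.
move=> A x Ax; exists A; split=> //.
apply: card_le_trans (card_leT A) _.
by apply: (@inj_card_leT Y (Y + nat) inl) => y z [].
Qed.

Lemma weak_tightnessP (X : topologicalType) :
  is_least_infinite (has_weak_tightness_le X) (weak_tightness X).
Proof.
apply: least_infiniteP.
pose K : Type := (tightness (set_type [set: X]) + (X + nat))%type.
exists K; split.
  apply/infiniteP; apply: (@inj_card_leT nat K (fun n => inr (inr n))).
  by move=> m n [].
exists [set [set: X]]; split.
- by rewrite bigcup_set1.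
- apply: (card_le_trans (card_leT _)).
  apply: (@inj_card_leT (set X) (set K)
    (fun U k => if k is inr (inl x) then U x else False)) => U V UV.
  by apply/funext => x; have := congr1 (fun S : set K => S (inr (inl x))) UV.
- move=> _ ->; split; first by apply: (@inj_card_leT _ K inl) => y z [].
  rewrite -subTset => x _; exists [set: X]; last exact: subset_closure.
  split=> //.
  apply: (@inj_card_leT X (set K) (fun x => [set inr (inl x)])) => y z yz.
  have : [set (inr (inl z) : K)] (inr (inl y)) by rewrite -yz.
  by case.
Qed.

Lemma pi_characterP (X : topologicalType) :
  is_least_infinite (has_pi_character_le X) (pi_character X).
Proof.
apply: least_infiniteP; exists (set X + nat)%type; split.
  exact: infinite_sum_nat.
move=> x; exists [set U | open U /\ U !=set0]; split.
  split=> // V; rewrite nbhsE => -[U [oU Ux] UV]; exists U => //.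
  by split=> //; exists x.
apply: card_le_trans (card_leT _) _.
by apply: (@inj_card_leT _ (set X + nat) inl) => y z [].
Qed.

(* Main.v *)
Require Import Defs.
From mathcomp Require Import all_boot all_order.
From mathcomp Require Import all_classical topology.

(* Let kappa be the product of the weak tightness and the pi-character, and call
   a set small if it has at most 2^kappa elements. Given a cover witnessing weak
   tightness, call A saturated if it meets every member C of the cover in a
   dense subset of A. Every small set has a small saturated superset, and each
   point of the closure of a saturated set is in the closure of a subset of size
   at most kappa.

   1. Some nonempty closed G_kappa-set lies in the closure of a small set.
      Otherwise one could build a long chain of pairs (A, G) with A small and
      saturated and G a nonempty closed G_kappa-set missing the closure of A,
      where A increases to a set A', G decreases and the next A always meets the
      previous G. By compactness some point of the closure of A' is in every G;
      but it is already in the closure of some A.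
   2. By homogeneity such sets cover X. The closure of a set B of size at most
      kappa has at most 2^kappa traces of closed G_kappa-sets, so a closing-off
      argument under operations of arity kappa gives a small dense set.
   3. Fix a local pi-base V_k at a point p, homeomorphisms h_x taking p to x,
      and points of a dense set D in the h_x(V_k). By the Hausdorff property x
      is determined by these points, so |X| <= |D|^kappa. *)

Set Implicit Arguments.
Unset Strict Implicit.
Unset Printing Implicit Defensive.

Local Open Scope classical_set_scope.
Local Open Scope card_scope.

(** * Total functions extracted from comparisons of cardinals *)

Lemma card_le_setP T U (A : set T) (B : set U) : A #<= B -> U ->
  exists f : T -> U, (forall x, A x -> B (f x)) /\
    (forall x y, A x -> A y -> f x = f y -> x = y).
Proof.
move=> /card_leP[f] u.
pose g x := if pselect (A x) is left Ax then
  set_val (f (SigSub (mem_set Ax))) else u.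
exists g; split=> [x Ax|x y Ax Ay]; rewrite /g.
  by case: pselect => // ?; exact: set_valP.
case: pselect => // Ax'; case: pselect => // Ay' /val_inj.
by move=> /(@inj _ _ _ f); rewrite !inE => /(_ I I) /(congr1 val).
Qed.

Lemma card_leT_inj T U : [set: T] #<= [set: U] -> exists f : T -> U, injective f.
Proof.
move=> TU; have [[u]|nU] := pselect (inhabited U).
  have [f [_ finj]] := card_le_setP TU u.
  by exists f => x y; apply: finj.
move/card_leP: TU => -[f].
have nT (t : T) : False.
  by apply: nU; constructor; exact: set_val (f (SigSub (mem_set (I : [set: T] t)))).
by exists (fun t => match nT t with end) => x; case: (nT x).
Qed.

Lemma card_le_range T U (A : set T) : A #<= [set: U] -> A !=set0 ->
  exists f : U -> T, range f = A.
Proof.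
move=> AU [a Aa].
have [[u]|nU] := pselect (inhabited U); last first.
  case/card_leP: AU => f; exfalso; apply: nU; constructor.
  exact: set_val (f (SigSub (mem_set Aa))).
have [f [_ finj]] := card_le_setP AU u.
have /choice[g gP] : forall v : U, exists x, A x /\ ((exists2 y, A y & f y = v) -> f x = v).
  move=> v; have [[y Ay fy]|n] := pselect (exists2 y, A y & f y = v).
    by exists y.
  by exists a.
exists g; apply/seteqP; split=> [_ [v _ <-]|x Ax]; first by have [] := gP v.
exists (f x) => //; have [Ag fg] := gP (f x).
by apply: finj => //; apply: fg; exists x.
Qed.

Lemma card_le_rangel T U (f : T -> U) V : [set: T] #<= [set: V] ->
  range f #<= [set: V].
Proof. exact/card_le_trans/card_image_le. Qed.

(** * Cardinal arithmetic *)

Section square.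
Context {K : Type}.

(* R is the graph of an injection D * D -> D with D := graph_dom R. *)
Definition graph_dom (R : set (K * K * K)) (a : K) := exists c, R (a, a, c).

Definition pairing_graph (R : set (K * K * K)) :=
  [/\ forall p q, R p -> R q -> (p.1 = q.1 <-> p.2 = q.2),
      forall p, R p -> [/\ graph_dom R p.1.1, graph_dom R p.1.2 & graph_dom R p.2] &
      forall a b, graph_dom R a -> graph_dom R b -> exists c, R (a, b, c)].

(** Each condition on a pairing graph concerns at most two triples at a time, so it can be checked
    inside some [V]. This handles unions of chains. *)
Lemma pairing_graph_directed (U : set (K * K * K)) :
  (forall p q, U p -> U q ->
     exists V, [/\ pairing_graph V, V `<=` U, V p & V q]) ->
  pairing_graph U.
Proof.
move=> dirU.
have domS V : V `<=` U -> forall a, graph_dom V a -> graph_dom U a.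
  by move=> VU a [c /VU]; exists c.
split.
- by move=> p q /dirU /[apply] -[V [[+ _ _] _]]; apply.
- move=> p Up; have [V [[_ domV _] VU Vp _]] := dirU _ _ Up Up.
  by have [? ? ?] := domV _ Vp; split; apply: domS VU _ _.
- move=> a b [c Uc] [d Ud]; have [V [[_ _ totV] VU Vc Vd]] := dirU _ _ Uc Ud.
  by have [|| x Vx] := totV a b; [exists c|exists d|exists x; apply: VU].
Qed.

Lemma pairing_graph_nat (i : nat -> K) : injective i ->
  pairing_graph [set p | exists m n, p = (i m, i n, i (pickle (m, n)))].
Proof.
move=> iinj; set R := [set p | _].
have domR m : graph_dom R (i m) by exists (i (pickle (m, m))), m, m.
split.
- move=> _ _ [m [n ->]] [m' [n' ->]] /=; split=> [[/iinj-> /iinj->] //|].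
  by move=> /iinj /(pcan_inj pickleK) [-> ->].
- by move=> _ [m [n ->]]; split; exact: domR.
- move=> a b [c [m [n [-> _ _]]]] [d [m' [n' [-> _ _]]]].
  by exists (i (pickle (m, m'))), m, m'.
Qed.

(* A pair in (D `|` e @` D)^2 but not in D^2 is sent into e @` D; its coordinates
   are coded by elements of D and by tags telling whether [e] is applied. *)
Lemma pairing_graph_extend (R : set (K * K * K)) (f : K * K -> K) (e : K -> K)
    (s : bool -> K) :
  pairing_graph R ->
  (forall a b, graph_dom R a -> graph_dom R b -> R (a, b, f (a, b))) ->
  (forall a, graph_dom R a -> ~ graph_dom R (e a)) ->
  (forall a b, graph_dom R a -> graph_dom R b -> e a = e b -> a = b) ->
  (forall t, graph_dom R (s t)) -> injective s ->
  exists2 R', pairing_graph R' & R `<` R'.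
Proof.
move=> [Rinj Rdom Rtot] fR eD einj sD sinj.
pose emb (t : bool) a := if t then e a else a.
pose code a b t t' := e (f (f (a, b), f (s t, s t'))).
pose N := [set p | exists a b t t',
  [/\ graph_dom R a, graph_dom R b, t || t' &
      p = (emb t a, emb t' b, code a b t t')]].
have fD a b : graph_dom R a -> graph_dom R b -> graph_dom R (f (a, b)).
  by move=> Da Db; have [] := Rdom _ (fR _ _ Da Db).
have finj a b a' b' : graph_dom R a -> graph_dom R b -> graph_dom R a' ->
    graph_dom R b' -> f (a, b) = f (a', b') -> (a, b) = (a', b').
  by move=> Da Db Da' Db' ff; apply/(Rinj _ _ (fR _ _ Da Db) (fR _ _ Da' Db')).
have embinj t a t' a' : graph_dom R a -> graph_dom R a' ->
    emb t a = emb t' a' -> (a, t) = (a', t').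
  move=> Da Da'; rewrite /emb; case: t t' => -[] //.
  - by move/einj => -> //.
  - by move=> ea; exfalso; apply: (eD _ Da); rewrite ea.
  - by move=> ea; exfalso; apply: (eD _ Da'); rewrite -ea.
  - by move=> ->.
have codeD a b t t' : graph_dom R a -> graph_dom R b ->
    graph_dom R (f (f (a, b), f (s t, s t'))).
  by move=> Da Db; apply: (fD); apply: fD.
have codeinj a b t t' a' b' u u' : graph_dom R a -> graph_dom R b ->
    graph_dom R a' -> graph_dom R b' -> code a b t t' = code a' b' u u' ->
    [/\ a = a', b = b', t = u & t' = u'].
  move=> Da Db Da' Db' eq_code.
  have := einj _ _ (codeD _ _ _ _ Da Db) (codeD _ _ _ _ Da' Db') eq_code.
  move=> /(finj _ _ _ _ (fD _ _ Da Db) (fD _ _ (sD _) (sD _))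
                        (fD _ _ Da' Db') (fD _ _ (sD _) (sD _)))[].
  move=> /(finj _ _ _ _ Da Db Da' Db')[-> ->].
  by move=> /(finj _ _ _ _ (sD _) (sD _) (sD _) (sD _))[/sinj-> /sinj->].
have emb_dom t a : graph_dom R a -> graph_dom (R `|` N) (emb t a).
  case: t => /= Da; last by case: Da => c Rc; exists c; left.
  by exists (code a a true true); right; exists a, a, true, true.
have dom_emb a : graph_dom (R `|` N) a -> exists t a', graph_dom R a' /\ a = emb t a'.
  move=> [c [Rc|[x [y [t [t' [Dx Dy tt' [ax ay cE]]]]]]]].
    by exists false, a; split => //; exists c.
  by exists t, x.
have RN p q : R p -> N q -> p.1 = q.1 <-> p.2 = q.2.
  move=> Rp [a [b [t [t' [Da Db tt' ->]]]]] /=.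
  have [D1 D2 D3] := Rdom _ Rp; split=> [E|E].
    move: D1 D2; rewrite E /= => D1 D2; exfalso; case/orP: tt' => tt.
      by move: D1; rewrite tt; exact: eD.
    by move: D2; rewrite tt; exact: eD.
  by exfalso; move: D3; rewrite E; apply: eD; apply: codeD.
exists (R `|` N).
  split.
  - move=> p q [Rp|Np] [Rq|Nq]; [exact: Rinj|exact: RN|..].
      by have H := RN _ _ Rq Np; split=> E; apply/esym/H/esym.
    move: Np Nq => [a [b [t [t' [Da Db tt' ->]]]]] [c [d [u [u' [Dc Dd uu' ->]]]]] /=.
    split=> [[/(embinj _ _ _ _ Da Dc)[-> ->] /(embinj _ _ _ _ Db Dd)[-> ->]] //|].
    by move=> /(codeinj _ _ _ _ _ _ _ _ Da Db Dc Dd)[-> -> -> ->].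
  - move=> p [Rp|[a [b [t [t' [Da Db tt' ->]]]]]] /=.
      by have [D1 D2 D3] := Rdom _ Rp; split; apply: (emb_dom false).
    split; [exact: emb_dom|exact: emb_dom|].
    by apply: (emb_dom true); apply: codeD.
  - move=> _ _ /dom_emb[t [a [Da ->]]] /dom_emb[t' [b [Db ->]]].
    case tt' : (t || t').
      by exists (code a b t t'); right; exists a, b, t, t'.
    case: t t' tt' => -[] //= _.
    by exists (f (a, b)); left; apply: fR.
split=> [|RNR]; first by move=> p; left.
apply: (eD _ (sD true)); exists (code (s true) (s true) true true).
by apply: RNR; right; exists (s true), (s true), true, true.
Qed.

(** A maximal pairing graph containing a countable one has a domain [D] with an injection
    [D * D -> D]. If [D] injects into its complement, the graph extends; otherwise the complement
    injects into [D], hence so does [K]. *)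
Lemma infinite_square : infinite_set [set: K] -> [set: K * K] #<= [set: K].
Proof.
move=> /infiniteP /card_leT_inj[i iinj].
set R0 := [set p : K * K * K | exists m n, p = (i m, i n, i (pickle (m, n)))].
have R0g : pairing_graph R0 := pairing_graph_nat iinj.
(* Adjoining [R0] to every candidate forces the range of [i] into the domain. *)
have [F Fg Ft|A [Ag Amax]] :=
    @Zorn_bigcup _ [set R | pairing_graph (R `|` R0)].
  apply: pairing_graph_directed => p q.
  have sub S : F S -> S `|` R0 `<=` \bigcup_(X in F) X `|` R0.
    by move=> FS; apply: setSU => x Sx; exists S.
  move=> [[S FS Sp]|R0p] [[S' FS' S'q]|R0q].
  - have [SS'|S'S] := Ft _ _ FS FS'.
      exists (S' `|` R0); split; [exact: Fg|exact: sub|left; exact: SS'|by left].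
    exists (S `|` R0); split; [exact: Fg|exact: sub|by left|left; exact: S'S].
  - by exists (S `|` R0); split; [exact: Fg|exact: sub|left|right].
  - by exists (S' `|` R0); split; [exact: Fg|exact: sub|right|left].
  - by exists R0; split => // x; right.
set R := A `|` R0 in Ag; pose D : set K := graph_dom R.
have iD n : D (i n) by exists (i (pickle (n, n))); right; exists n, n.
have [Rinj Rdom Rtot] := Ag.
have [f fR] : exists f : K * K -> K, forall a b, D a -> D b -> R (a, b, f (a, b)).
  have /choice[f fP] : forall p : K * K, exists c, D p.1 -> D p.2 -> R (p, c).
    move=> [a b]; have [[Da Db]|n] := pselect (D a /\ D b).
      by have [c Rc] := Rtot _ _ Da Db; exists c.
    by exists (i 0) => /= Da Db; case: n.
  by exists f => a b Da Db; apply: fP.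
have finj a b a' b' : D a -> D b -> D a' -> D b' -> f (a, b) = f (a', b') ->
    (a, b) = (a', b').
  by move=> Da Db Da' Db' ff; apply/(Rinj _ _ (fR _ _ Da Db) (fR _ _ Da' Db')).
have fD a b : D a -> D b -> D (f (a, b)).
  by move=> Da Db; have [] := Rdom _ (fR _ _ Da Db).
pose s (t : bool) := i t.
have sinj : injective s by move=> t u /iinj; case: t u => -[].
have [DC|CD] := card_leT_total D (~` D : set K).
  move: DC; rewrite (card_le_eql (card_setT _)) (card_le_eqr (card_setT _)).
  move=> /card_le_setP /(_ (i 0))[e [eD einj]].
  have [R' R'g [RR' R'R]] := pairing_graph_extend Ag fR eD einj (fun t => iD t) sinj.
  have AR' : A `<` R'.
    by split=> [x Ax|R'A]; [apply: RR'; left|apply: R'R => x /R'A; left].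
  case: (Amax _ AR').
  by rewrite /= setUidl // => x R0x; apply: RR'; right.
move: CD; rewrite (card_le_eql (card_setT _)) (card_le_eqr (card_setT _)).
move=> /card_le_setP /(_ (i 0))[g [gD ginj]].
(* [K] goes into [D] as two tagged copies: elements of [D] get the tag [s false], the others are
   moved into [D] by [g] and get [s true]. *)
pose j x := if x \in D then f (s false, x) else f (s true, g x).
have jD x : D (j x).
  rewrite /j; case: ifPn => [/set_mem Dx|/negP nDx]; first by apply: fD (iD _) Dx.
  by apply: fD; [exact: iD|apply: gD => Dx; apply: nDx; exact: mem_set].
have sD t : D (s t) by exact: iD.
have gD' x : x \notin D -> D (g x).
  by move=> /negP nDx; apply: gD => Dx; apply: nDx; exact: mem_set.
have jinj : injective j.
  move=> x y; rewrite /j; case: ifPn => [/set_mem Dx|nDx];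
    case: ifPn => [/set_mem Dy|nDy].
  - by move=> /(finj _ _ _ _ (sD _) Dx (sD _) Dy)[].
  - by move=> /(finj _ _ _ _ (sD _) Dx (sD _) (gD' _ nDy))[/sinj].
  - by move=> /(finj _ _ _ _ (sD _) (gD' _ nDx) (sD _) Dy)[/sinj].
  - move=> /(finj _ _ _ _ (sD _) (gD' _ nDx) (sD _) (gD' _ nDy))[].
    by apply: ginj => Dz; [case/negP: nDx|case/negP: nDy]; exact: mem_set.
apply: (@inj_card_leT _ _ (fun p => f (j p.1, j p.2))) => -[x y] [x' y'] /=.
by move=> /(finj _ _ _ _ (jD _) (jD _) (jD _) (jD _))[/jinj-> /jinj->].
Qed.

End square.

Lemma card_leT_prod T T' U U' : [set: T] #<= [set: T'] ->
  [set: U] #<= [set: U'] -> [set: T * U] #<= [set: T' * U'].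
Proof.
move=> /card_leT_inj[f finj] /card_leT_inj[g ginj].
by apply: (@inj_card_leT _ _ (fun p => (f p.1, g p.2))) => -[x y] [x' y'] [/finj/= -> /ginj/= ->].
Qed.

Lemma card_leT_fun T U U' : [set: U] #<= [set: U'] ->
  [set: T -> U] #<= [set: T -> U'].
Proof.
move=> /card_leT_inj[f finj]; apply: (@inj_card_leT _ _ (fun g => f \o g)).
by move=> g h gh; apply/funext => x; apply/finj; exact: (congr1 (@^~ x) gh).
Qed.

Lemma card_leT_set T U : [set: T] #<= [set: U] -> [set: set T] #<= [set: set U].
Proof.
move=> /card_leT_inj[f finj]; apply: (@inj_card_leT _ _ (fun A => f @` A)) => A B AB.
by apply/funext => x; rewrite -(image_inj finj) AB image_inj.
Qed.

Lemma card_leT_uncurry T U : [set: T -> set U] #<= [set: set (T * U)].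
Proof.
apply: (@inj_card_leT _ _ (fun g => [set p | g p.1 p.2])) => g h gh.
by apply/funext => x; apply/funext => y; exact: (congr1 (@^~ (x, y)) gh).
Qed.

Lemma card_leT_set1 T : [set: T] #<= [set: set T].
Proof. by apply: (@inj_card_leT _ _ set1) => x y xy; have : [set y] x by rewrite -xy. Qed.

(** * Powers of an infinite cardinal and closure under operations of infinite arity *)

Section infinite_type.
Context {K : Type}.
Hypothesis infK : infinite_set [set: K].

Lemma infinite_inj_nat : exists i : nat -> K, injective i.
Proof. exact/card_leT_inj/infiniteP. Qed.

Lemma infinite_surj_nat : exists s : K -> nat, range s = [set: nat].
Proof.
have [i iinj] := infinite_inj_nat.
have [||s <-] := @card_le_range nat K [set: nat]; [exact/infiniteP| |by exists s].
by exists 0.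
Qed.

Lemma infinite_pairing : exists (e : K * K -> K) (d : K -> K * K), cancel e d.
Proof.
have [e einj] := card_leT_inj (infinite_square infK).
have [i _] := infinite_inj_nat.
have /choice[d dP] : forall k, exists p, (exists q, e q = k) -> e p = k.
  move=> k; have [[p pk]|n] := pselect (exists q, e q = k); first by exists p.
  by exists (i 0, i 0).
by exists e, d => p; apply: einj; apply: dP; exists p.
Qed.

Lemma infinite_option : [set: option K] #<= [set: K].
Proof.
apply: card_le_trans (infinite_square infK); have [i iinj] := infinite_inj_nat.
apply: (@inj_card_leT _ _ (oapp (pair (i 0)) (i 1, i 0))).
by move=> [x|] [y|] //= [] => [->|/iinj|/iinj].
Qed.

Lemma infinite_seq : [set: seq K] #<= [set: K].
Proof.
have [e [d ed]] := infinite_pairing.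
have [o oinj] := card_leT_inj infinite_option.
pose fix code s := if s is k :: s' then o (Some (e (k, code s'))) else o None.
apply: (@inj_card_leT _ _ code); elim=> [|k s IHs] [|l t] //= /oinj // [].
by move=> /(can_inj ed)[-> /IHs ->].
Qed.

Lemma infinite_double : exists s : K -> K + K, range s = [set: K + K].
Proof.
have [i iinj] := infinite_inj_nat.
have [| |s <-] := @card_le_range (K + K) K [set: K + K]; last by exists s.
  apply: card_le_trans (infinite_square infK).
  apply: (@inj_card_leT _ _
    (fun u => match u with inl k => (i 0, k) | inr k => (i 1, k) end)).
  by move=> [x|x] [y|y] // [] => [->|/iinj|/iinj|->].
by exists (inl (i 0)).
Qed.

(** The bound is $2^K\cdot 2^K\le(2^K)^K\le 2^{K\cdot K}\le 2^K$. A pair becomes the function with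
    value [p.1] at [i 0], [p.2] at [i 1] and the empty set elsewhere. *)
Lemma card_leT_pow_prod T U : [set: T] #<= [set: set K] ->
  [set: U] #<= [set: set K] -> [set: T * U] #<= [set: set K].
Proof.
move=> TK UK; apply: card_le_trans (card_leT_prod TK UK) _.
apply: card_le_trans (card_leT_set (infinite_square infK)).
apply: card_le_trans (card_leT_uncurry _ _).
have [i iinj] := infinite_inj_nat.
apply: (@inj_card_leT _ _ (fun (p : set K * set K) k =>
  [set l | k = i 0 /\ p.1 l \/ k = i 1 /\ p.2 l])) => -[A B] [A' B'] AB.
have n01 : i 0 = i 1 -> False by move/iinj.
congr pair; apply/funext => l.
  have := congr1 (fun g : K -> set K => g (i 0) l) AB => /= E.
  apply/propext; split => Al.
    by have : i 0 = i 0 /\ A' l \/ i 0 = i 1 /\ B' l;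
      [rewrite -E; left|case=> -[]].
  by have : i 0 = i 0 /\ A l \/ i 0 = i 1 /\ B l;
      [rewrite E; left|case=> -[]].
have := congr1 (fun g : K -> set K => g (i 1) l) AB => /= E.
apply/propext; split => Al.
  by have : i 1 = i 0 /\ A' l \/ i 1 = i 1 /\ B' l;
    [rewrite -E; right|case=> -[] // /esym].
by have : i 1 = i 0 /\ A l \/ i 1 = i 1 /\ B l;
    [rewrite E; right|case=> -[] // /esym].
Qed.

Lemma card_leT_pow_fun T : [set: T] #<= [set: set K] ->
  [set: K -> T] #<= [set: set K].
Proof.
move=> TK; apply: card_le_trans (card_leT_fun _ TK) _.
apply: card_le_trans (card_leT_uncurry _ _) _.
exact/card_leT_set/infinite_square.
Qed.

Lemma card_leT_pow_option T : [set: T] #<= [set: set K] ->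
  [set: option T] #<= [set: set K].
Proof.
move=> /card_leT_inj[f finj]; apply: card_le_trans (card_leT_set infinite_option).
apply: (@inj_card_leT _ _ (fun o => if o is Some t then None |` (Some @` f t) else set0)).
move=> [x|] [y|] // E.
- congr Some; apply: finj; apply/funext => k; apply/propext.
  have H A : f A k <-> (None |` (Some @` f A)) (Some k).
    by split=> [fk|[|[l fl [<-]]]//]; right; exists k.
  by rewrite !H E.
- by have : set0 (@None K) by rewrite -E; left.
- by have : set0 (@None K) by rewrite E; left.
Qed.

Lemma card_le_pow_bigcup T (A : K -> set T) :
  (forall k, A k #<= [set: set K]) -> \bigcup_k A k #<= [set: set K].
Proof.
move=> AK; have [[x0]|nT] := pselect (inhabited T); last first.
  by apply: card_le_trans (card_ge0 _ _); apply: subset_card_le => x; case: nT.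
have /choice[h hP] : forall k, exists h : set K -> T, A k `<=` range h.
  move=> k; have [Ak|n] := pselect (A k !=set0).
    by have [h <-] := card_le_range (AK k) Ak; exists h.
  by exists (fun=> x0) => x Ax; case: n; exists x.
apply: card_le_trans (card_le_rangel (fun p => h p.1 p.2)
  (card_leT_pow_prod (card_leT_set1 _) (card_lexx _))).
apply: subset_card_le => x [k _ /hP[s _ <-]].
by exists (k, s).
Qed.

Lemma card_le_pow_setU T (A B : set T) : A #<= [set: set K] ->
  B #<= [set: set K] -> A `|` B #<= [set: set K].
Proof.
move=> AK BK; have [i iinj] := infinite_inj_nat.
pose F k := if pselect (k = i 0) is left _ then A else B.
have FK k : F k #<= [set: set K] by rewrite /F; case: pselect.
apply: card_le_trans (card_le_pow_bigcup FK); apply: subset_card_le.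
move=> x [Ax|Bx]; first by exists (i 0) => //; rewrite /F; case: pselect.
by exists (i 1) => //; rewrite /F; case: pselect => // /iinj.
Qed.

(* An element of the closure of a set under a K-ary operation is the value of
   a well-founded tree. A tree is coded by the function sending each finite
   path in it to the label found there, so there are at most 2^K trees. *)
Inductive term (L : Type) := Const | Node of L & (K -> term L).

Fixpoint term_code L (t : term L) (p : seq K) : option L :=
  match t, p with
  | Const, _ => None
  | Node l _, [::] => Some l
  | Node _ f, k :: p' => term_code (f k) p'
  end.

Lemma term_code_inj L : injective (@term_code L).
Proof.
elim=> [|l f IHf] [|l' f'] // E.
- by have := congr1 (@^~ [::]) E.
- by have := congr1 (@^~ [::]) E.
have [->] : Some l = Some l' := congr1 (@^~ [::]) E.
congr Node; apply/funext => k; apply: IHf.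
by apply/funext => p; exact: (congr1 (@^~ (k :: p)) E).
Qed.

Lemma card_leT_term L : [set: L] #<= [set: set K] ->
  [set: term L] #<= [set: set K].
Proof.
move=> LK; apply: card_le_trans (inj_card_leT (@term_code_inj L)) _.
apply: card_le_trans (card_leT_fun _ (card_leT_pow_option LK)) _.
apply: card_le_trans (card_leT_uncurry _ _) _; apply: card_leT_set.
apply: card_le_trans (infinite_square infK).
exact: card_leT_prod infinite_seq (card_lexx _).
Qed.

(** Values of well-founded trees replace an iteration of length $\kappa^+$: [K] values come from [K]
    trees, which are the children of one new node. *)
Lemma closing_off X (A0 : set X) (op : (K -> X) -> set X) :
  A0 #<= [set: set K] -> (forall f, op f #<= [set: set K]) ->
  exists A : set X, [/\ A0 `<=` A, A #<= [set: set K] &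
    forall f, (forall k, A (f k)) -> op f `<=` A].
Proof.
move=> A0K opK; have [[x0]|nX] := pselect (inhabited X); last first.
  by exists A0; split => // f _ x; case: nX; constructor.
(* The labels enumerate [op f]; [A0] is included so that a node over any children can produce its
   points. *)
have /choice[h hP] : forall f, exists h : set K -> X, A0 `|` op f `<=` range h.
  move=> f; have [|n] := pselect (A0 `|` op f !=set0).
    move=> /(card_le_range (card_le_pow_setU A0K (opK f)))[h <-].
    by exists h.
  by exists (fun=> x0) => x Ax; case: n; exists x.
pose fix eval (t : term (set K)) : X :=
  if t is Node l g then h (eval \o g) l else x0.
exists (range eval); split.
- move=> x A0x; have [l _ <-] : range (h (eval \o fun=> Const _)) x.
    by apply: hP; left.
  by exists (Node l (fun=> Const _)).
- exact/card_le_rangel/card_leT_term/card_lexx.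
- move=> f fP x opx.
  have /choice[g gP] : forall k, exists t, eval t = f k.
    by move=> k; have [t _ tk] := fP k; exists t.
  have [l _ <-] : range (h f) x by apply: hP; right.
  exists (Node l g) => //=; congr h.
  by apply/funext => k; exact: gP.
Qed.

End infinite_type.

(** * Closed sets of type G_K and saturated sets in a compactum *)

Section compactum.
Context {X : topologicalType} {K : Type}.
Hypothesis infK : infinite_set [set: K].

(* A closed G_K-set is represented as the intersection of a regular family:
   the condition on closures makes the intersection closed. *)
Definition regular_family (U : K -> set X) :=
  (forall k, open (U k)) /\ forall k, exists k', closure (U k') `<=` U k.

Lemma closed_regular_family U : regular_family U -> closed (\bigcap_k U k).
Proof.
move=> [_ Ureg] x clx k _; have [k' Uk'] := Ureg k.
by apply/Uk'/(closureS _ clx) => y; exact.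
Qed.

Lemma regular_family_setT : regular_family (fun=> setT).
Proof. by split=> k; [exact: openT|exists k]. Qed.

Lemma regular_family_bigcap (U : K -> K -> set X) :
  (forall i, regular_family (U i)) ->
  exists2 V, regular_family V & \bigcap_k V k = \bigcap_i \bigcap_k U i k.
Proof.
move=> Ureg; have [e [d ed]] := infinite_pairing infK.
exists (fun k => U (d k).1 (d k).2).
  split=> k; first by have [] := Ureg (d k).1.
  have [_ /(_ (d k).2)[k' k'P]] := Ureg (d k).1.
  by exists (e ((d k).1, k')); rewrite ed.
apply/seteqP; split=> x xU; last by move=> k _; exact: xU.
by move=> i _ k _; have := xU (e (i, k)) I; rewrite ed.
Qed.

Lemma regular_family_setI (U V : K -> set X) :
  regular_family U -> regular_family V ->
  exists2 W, regular_family W & \bigcap_k W k = \bigcap_k U k `&` \bigcap_k V k.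
Proof.
move=> Ureg Vreg; have [i iinj] := infinite_inj_nat infK.
pose F k := if pselect (k = i 0) is left _ then U else V.
have [|W Wreg WE] := @regular_family_bigcap F.
  by move=> k; rewrite /F; case: pselect.
exists W => //; rewrite WE; apply/seteqP; split=> [x xF|x [xU xV] k _].
  split=> k _; first by have := xF (i 0) I k I; rewrite /F; case: pselect.
  by have := xF (i 1) I k I; rewrite /F; case: pselect => // /iinj.
by rewrite /F; case: pselect.
Qed.

Lemma regular_family_preimage (g : X -> X) U : continuous g ->
  regular_family U -> regular_family (fun k => g @^-1` U k).
Proof.
move=> cg [Uo Ureg]; split=> k; first by apply: open_comp => // x _; exact: cg.
have [k' k'P] := Ureg k; exists k' => x clx; apply: k'P => B /cg gB.
by have [y [Uy By]] := clx _ gB; exists (g y).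
Qed.

Hypothesis compactX : compact [set: X].
Hypothesis hausdorffX : hausdorff_space X.

(** Starting from the complement of [D], regularity of [X] gives open sets around [y], each
    containing the closure of the next. A surjection from [K] onto [nat] reindexes the sequence. *)
Lemma regular_family_avoid (D : set X) y : closed D -> ~ D y ->
  exists U, [/\ regular_family U, (\bigcap_k U k) y & \bigcap_k U k `<=` ~` D].
Proof.
move=> cD nDy; have [s sT] := infinite_surj_nat infK.
have sn n : exists k, s k = n.
  by have [k _ <-] : range s n; [rewrite sT|exists k].
have /choice[f fP] : forall W : set X, exists W', open W /\ W y ->
    [/\ open W', W' y & closure W' `<=` W].
  move=> W; have [[Wo Wy]|n] := pselect (open W /\ W y); last by exists W.
  have [] := @compact_regular X y setT hausdorffX compactX filterT W.
    by apply: open_nbhs_nbhs.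
  move=> B /= By clB; have [W' [W'o W'y] W'B] : exists2 W', open_nbhs y W' & W' `<=` B.
    by move: By; rewrite nbhsE.
  by exists W' => _; split => //; apply: subset_trans clB; exact: closureS.
pose V n := iter n f (~` D).
have VP n : open (V n) /\ V n y.
  by elim: n => [|n IHn]; [rewrite openC|have [] := fP _ IHn].
exists (fun k => V (s k)); split.
- split=> k; first by have [] := VP (s k).
  by have [k' k'E] := sn (s k).+1; exists k'; rewrite k'E; have [] := fP _ (VP (s k)).
- by move=> k _; have [] := VP (s k).
- by move=> x xV; have [k k0] := sn 0; have := xV k I; rewrite k0.
Qed.

Lemma compact_directed (B : set (set X)) : B !=set0 ->
  (forall P Q, B P -> B Q -> exists2 R, B R & R `<=` P `&` Q) ->
  (forall P, B P -> P !=set0) -> exists x, forall P, B P -> closure P x.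
Proof.
move=> B0 Bdir Bne.
have FF : ProperFilter (filter_from B id).
  by apply: filter_from_proper => //; apply: filter_from_filter.
have [x [_ xF]] := compactX FF filterT.
by exists x => P BP N Nx; apply: xF => //; exists P.
Qed.

(* C lists the members of the cover and S x c a subset of C c with x in its
   closure; these come from weak tightness at most K. *)
Context (C : set K -> set X) (S : X -> set K -> set K -> X).
Hypothesis C_cover : forall x, exists c, C c x.
Hypothesis C_tight : forall c (A : set X) x, A `<=` C c -> C c x ->
  closure A x -> exists B, [/\ B `<=` A, B #<= [set: K] & closure B x].
Hypothesis S_sub : forall x c s, C c (S x c s).
Hypothesis S_closure : forall x c, closure (range (S x c)) x.

Definition saturated (A : set X) := forall c, A `<=` closure (A `&` C c).

Lemma saturated_stable (A : set X) :
  (forall x c s, A x -> A (S x c s)) -> saturated A.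
Proof.
move=> AS c x Ax; have := @S_closure x c; apply: closureS => _ [s _ <-].
by split; [exact: AS|exact: S_sub].
Qed.

(** Some [C c] contains [x]; saturation puts [x] in the closure of the part of [A] inside [C c],
    where tightness applies. *)
Lemma saturated_tight (A : set X) x : saturated A -> closure A x ->
  exists B, [/\ B `<=` A, B #<= [set: K] & closure B x].
Proof.
move=> satA clx; have [c Cx] := C_cover x.
have clC := closed_closure (closureS (@satA c) clx).
have [B [BA BK clB]] := C_tight (@subIsetr _ A (C c)) Cx clC.
by exists B; split => // y /BA[].
Qed.

(** The points added for saturation depend on one point; reading it at index [k0] gives the [K]-ary
    form that [closing_off] expects. *)
Definition satop (f : K -> X) (k0 : K) : set X :=
  range (fun p : set K * set K => S (f k0) p.1 p.2).

Lemma card_satop f k0 : satop f k0 #<= [set: set K].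
Proof. exact/card_le_rangel/card_leT_pow_prod/card_lexx/card_lexx. Qed.

Lemma saturated_hull (A0 : set X) : A0 #<= [set: set K] ->
  exists A, [/\ A0 `<=` A, A #<= [set: set K] & saturated A].
Proof.
move=> A0K; have [i _] := infinite_inj_nat infK.
have [A [A0A AK Aop]] := closing_off infK A0K (fun f => card_satop f (i 0)).
exists A; split => //; apply: saturated_stable => x c s Ax.
by apply: (Aop (fun=> x)) => //; exists (c, s).
Qed.


(* The pairs (A, G) of step 1 of the proof. *)
Let state := (set X * set X)%type.

Definition good_state (p : state) :=
  [/\ saturated p.1, p.1 #<= [set: set K], p.2 !=set0,
      p.2 `<=` ~` closure p.1 &
      exists2 U, regular_family U & p.2 = \bigcap_k U k].

Definition state_lt (p q : state) :=
  [/\ p.1 `<=` q.1, q.2 `<=` p.2 & q.1 `&` p.2 !=set0].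

(** The last clause of [state_lt] would make [p.1] meet [p.2], which misses the closure of [p.1]. *)
Lemma state_ltxx p : good_state p -> ~ state_lt p p.
Proof.
move=> [_ _ _ p21 _] [_ _ [x [p1x p2x]]]; apply: (p21 x p2x).
exact: subset_closure.
Qed.

Lemma state_lt_trans p q r : state_lt p q -> state_lt q r -> state_lt p r.
Proof.
move=> [pq qp [x [q1x p2x]]] [qr rq _]; split.
- exact: subset_trans qr.
- exact: subset_trans qp.
- by exists x; split => //; exact: qr.
Qed.

Definition state_chain (F : set state) := F `<=` good_state /\
  forall p q, F p -> F q -> [\/ p = q, state_lt p q | state_lt q p].

(** * Contradiction from long chains of states *)

Section no_small_cover.
Hypothesis no_small_cover : forall U, regular_family U -> \bigcap_k U k !=set0 ->
  forall A : set X, A #<= [set: set K] -> ~ (\bigcap_k U k `<=` closure A).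

(** By compactness the sets [p.2] have a common point [y]. By [no_small_cover] their intersection is
    not inside the closure of a small saturated set containing [y] and all [p.1], so it can be
    shrunk to miss that closure. *)
Lemma state_chain_bound F (T : set state) (x0 : X) :
  state_chain F -> T `<=` F -> T #<= [set: K] ->
  exists2 w, good_state w & forall p, T p -> state_lt p w.
Proof.
move=> [Fgood Flin] TF TK.
have [V Vreg [[y Vy] TV]] : exists2 V, regular_family V &
    \bigcap_k V k !=set0 /\ forall p, T p -> \bigcap_k V k `<=` p.2.
  have [[p0 Tp0]|Tn] := pselect (T !=set0); last first.
    exists (fun=> setT); first exact: regular_family_setT.
    by split; [exists x0|move=> p Tp; case: Tn; exists p].
  have [t tT] := card_le_range TK (ex_intro _ p0 Tp0).
  have tF k : F (t k) by apply: TF; rewrite -tT; exists k.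
  have /choice[U UP] : forall k, exists U, regular_family U /\
      (t k).2 = \bigcap_k U k.
    by move=> k; have [_ _ _ _ [U]] := Fgood _ (tF k); exists U.
  have [|V Vreg VE] := @regular_family_bigcap U; first by move=> k; have [] := UP k.
  have {}VE : \bigcap_k V k = \bigcap_k (t k).2.
    by rewrite VE; apply: eq_bigcapr => k _; have [] := UP k.
  exists V => //; rewrite VE; split; last first.
    by move=> p; rewrite -tT => -[k _ <-] x; apply.
  have [||_ [p Tp <-]|x xP] := @compact_directed [set p.2 | p in T].
  - by exists p0.2, p0.
  - move=> _ _ [p Tp <-] [q Tq <-].
    have [->|[_ qp _]|[_ pq _]] := Flin _ _ (TF _ Tp) (TF _ Tq).
    + by exists q.2 => //; exists q.
    + by exists q.2; [exists q|move=> x qx; split=> //; exact: qp].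
    + by exists p.2; [exists p|move=> x px; split=> //; exact: pq].
  - by have [] := Fgood _ (TF _ Tp).
  - exists x => k _; have [Ureg UE] := UP k; rewrite UE.
    apply: closed_regular_family => //; rewrite -UE.
    by apply: xP; exists (t k) => //; rewrite -tT; exists k.
(* The extra point [y] makes the new set meet every earlier [p.2]. *)
have AT : \bigcup_(p in T) p.1 `|` [set y] #<= [set: set K].
  apply: (card_le_pow_setU infK); last first.
    apply: card_le_trans (card_le_rangel (fun=> y) (card_leT_set1 K)).
    have [i _] := infinite_inj_nat infK.
    by apply: subset_card_le => _ ->; exists (i 0).
  have [T0|Tn] := pselect (T !=set0); last first.
    by apply: card_le_trans (card_ge0 _ _); apply: subset_card_le => x [p Tp];
      case: Tn; exists p.
  have [t tT] := card_le_range TK T0.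
  have tF k : F (t k) by apply: TF; rewrite -tT; exists k.
  rewrite -tT bigcup_image; apply: (card_le_pow_bigcup infK) => k.
  by have [] := Fgood _ (tF k).
have [A1 [AA1 A1K satA1]] := saturated_hull AT.
have [z [Vz nz]] : exists z, (\bigcap_k V k) z /\ ~ closure A1 z.
  apply: contrapT => n; apply: (no_small_cover Vreg _ A1K); first by exists y.
  by move=> z Vz; apply: contrapT => nz; apply: n; exists z.
have [W [Wreg Wz WA1]] := regular_family_avoid (@closed_closure _ A1) nz.
have [V2 V2reg V2E] := regular_family_setI Vreg Wreg.
exists (A1, \bigcap_k V2 k).
  split => //=; [by exists z; rewrite V2E|by rewrite V2E => x [_ /WA1]|].
  by exists V2.
move=> p Tp; split=> /=.
- by move=> x px; apply: AA1; left; exists p.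
- by rewrite V2E => x [Vx _]; exact: TV.
- by exists y; split; [apply: AA1; right|exact: TV].
Qed.


(** A maximal chain has cofinality above [K]. A limit point [z] of its union is in the closure of at
    most [K] points, which all lie in a single [q.1], although [z] is in [q.2]. *)
Lemma no_small_cover_absurd (x0 : X) : False.
Proof.
have [F Fc Ft|F [[Fgood Flin] Fmax]] := @Zorn_bigcup _ state_chain.
  split=> [p [G FG Gp]|p q [G FG Gp] [H FH Hq]]; first by have [+ _] := Fc _ FG; apply.
  have [GH|HG] := Ft _ _ FG FH.
    by have [_] := Fc _ FH; apply=> //; exact: GH.
  by have [_] := Fc _ FG; apply=> //; exact: HG.
have unbounded T : T `<=` F -> T #<= [set: K] ->
    exists2 q, F q & forall p, T p -> state_lt p q.
  move=> TF TK; have [w wgood Tw] := state_chain_bound x0 (conj Fgood Flin) TF TK.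
  (* If no member of [F] bounded [T], linearity would put all of [F] below [w], and [w] would extend
     the chain. *)
  apply: contrapT => nq.
  have Fw q : F q -> state_lt q w.
    move=> Fq; apply: contrapT => nqw; apply: nq; exists q => // p Tp.
    have [pq|//|qp] := Flin _ _ (TF _ Tp) Fq.
      by case: nqw; rewrite -pq; exact: Tw.
    by case: nqw; apply: state_lt_trans qp _; exact: Tw.
  apply: (Fmax (F `|` [set w])).
    split=> [p Fp|wF]; first by left.
    by apply: (state_ltxx wgood); apply: Fw; apply: wF; right.
  split=> [p [/Fgood//|->//]|p q [Fp|->] [Fq|->]].
  - exact: Flin.
  - by apply: Or32; exact: Fw.
  - by apply: Or33; exact: Fw.
  - exact: Or31.
pose A := \bigcup_(p in F) p.1.
have satA : saturated A.
  move=> c x [p Fp px]; have [satp _ _ _ _] := Fgood _ Fp.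
  by apply: closureS (satp c x px); apply: setSI => y py; exists p.
have next p : F p -> exists2 q, F q & state_lt p q.
  move=> Fp; have [||q Fq pq] := unbounded [set p].
  - by move=> _ ->.
  - apply: card_le_trans (card_le_rangel (fun=> p) (card_lexx [set: K])).
    have [i _] := infinite_inj_nat infK.
    by apply: subset_card_le => _ ->; exists (i 0).
  - by exists q => //; exact: pq.
(* These sets decrease along the chain, and are nonempty because a later state meets [p.2]. *)
have [|||z zP] := @compact_directed [set A `&` p.2 | p in F].
- have [q Fq _] := unbounded set0 (@sub0set _ _) (card_ge0 _ _).
  by exists (A `&` q.2), q.
- move=> _ _ [p Fp <-] [q Fq <-].
  have [->|[_ qp _]|[_ pq _]] := Flin _ _ Fp Fq.
  + by exists (A `&` q.2) => //; exists q.
  + by exists (A `&` q.2); [exists q|move=> x [Ax qx]; do !split => //; exact: qp].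
  + by exists (A `&` p.2); [exists p|move=> x [Ax px]; do !split => //; exact: pq].
- move=> _ [p Fp <-]; have [q Fq [_ _ [x [qx px]]]] := next p Fp.
  by exists x; split => //; exists q.
have zF p : F p -> closure A z /\ p.2 z.
  move=> Fp; have /closureI[clA clp] := zP _ (ex_intro2 _ _ p Fp erefl).
  split=> //; have [_ _ _ _ [U Ureg pU]] := Fgood _ Fp; rewrite pU in clp *.
  exact: closed_regular_family clp.
have [q0 Fq0 _] := unbounded set0 (@sub0set _ _) (card_ge0 _ _).
have [B [BA BK clB]] := saturated_tight satA (zF _ Fq0).1.
have [b0 [Bb0 _]] := clB _ filterT.
have [b bB] := card_le_range BK (ex_intro _ b0 Bb0).
have /choice[t tP] : forall k, exists p, F p /\ p.1 (b k).
  move=> k; have [|p Fp pb] := BA (b k); first by rewrite -bB; exists k.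
  by exists p.
have [||q Fq tq] := unbounded (range t).
- by move=> _ [k _ <-]; have [] := tP k.
- exact: card_le_rangel (card_lexx _).
have [_ _ _ /(_ z (zF _ Fq).2) + _] := Fgood _ Fq; apply.
apply: closureS clB; rewrite -bB => _ [k _ <-].
have [qk _ _] : state_lt (t k) q by apply: tq; exists k.
by apply: qk; have [] := tP k.
Qed.

End no_small_cover.

Lemma exists_small_cover (x0 : X) : exists U (A : set X),
  [/\ regular_family U, \bigcap_k U k !=set0, A #<= [set: set K] &
      \bigcap_k U k `<=` closure A].
Proof.
apply: contrapT => n; apply: no_small_cover_absurd x0 => U Ureg U0 A AK UA.
by apply: n; exists U, A.
Qed.

(** * A small dense set from a cover by small pieces *)

(** If [p] is outside the closure of the closed-off set [A], then open sets coded over [A] and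
    missing [p] cover this closure, while no [K] of them cover [A]. Compactness makes this
    contradictory. *)
Lemma exists_small_dense :
  (forall x, exists U (A : set X), [/\ regular_family U, (\bigcap_k U k) x,
     A #<= [set: set K] & \bigcap_k U k `<=` closure A]) ->
  exists2 D : set X, D #<= [set: set K] & closure D = setT.
Proof.
move=> covX; have [[x0]|nX] := pselect (inhabited X); last first.
  exists set0; first exact: card_ge0.
  by apply/seteqP; split=> x; case: nX; constructor.
have /choice[U /choice[H UH]] := covX.
have [i _] := infinite_inj_nat infK.
have [e [d ed]] := infinite_pairing infK.
(* If [b] enumerates a set B, then [c] determines the trace of the intersection
   of [U x] on the closure of B: it is the intersection of the closures of the
   traces [B `&` U x k]. *)
pose code x (b : K -> X) (c : set (K * K)) := forall k j, c (k, j) <-> U x k (b j).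
(* One representative per code leaves at most $2^K$ families for a given [b]. *)
have /choice[pt ptP] : forall bc : (K -> X) * set (K * K), exists x,
    (exists y, code y bc.1 bc.2) -> code x bc.1 bc.2.
  move=> bc; have [[x xbc]|n] := pselect (exists y, code y bc.1 bc.2).
    by exists x.
  by exists x0.
have /choice[out outP] : forall W : set X, exists y, W != setT -> ~ W y.
  move=> W; have [[y nWy]|n] := pselect (exists y, ~ W y); first by exists y.
  exists x0 => /eqP[]; apply/seteqP; split=> // y _.
  by apply: contrapT => ?; apply: n; exists y.
(* Pairing lets one [K]-sequence carry [K] many of them, so [op2] can treat [K] coded open sets at
   once and add a point outside their union. *)
pose part (f : K -> X) i := fun j => f (e (i, j)).
pose member (l : set (K * K) * K) b := U (pt (b, l.1)) l.2.
pose op1 f := \bigcup_c H (pt (f, c)).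
pose op2 f := range (fun l : K -> set (K * K) * K =>
  out (\bigcup_i member (l i) (part f i))).
have powK2 : [set: set (K * K)] #<= [set: set K].
  exact/card_leT_set/infinite_square.
have op1K f : op1 f #<= [set: set K].
  have /choice[h hP] : forall c, exists h : set K -> X, H (pt (f, c)) `<=` range h.
    move=> c; have [|n] := pselect (H (pt (f, c)) !=set0).
      by have [_ _ HK _] := UH (pt (f, c)) => /(card_le_range HK)[h <-]; exists h.
    by exists (fun=> x0) => x Hx; case: n; exists x.
  apply: card_le_trans (card_le_rangel (fun p => h p.1 p.2)
    (card_leT_pow_prod infK powK2 (card_lexx _))).
  by apply: subset_card_le => x [c _ /hP[s _ <-]]; exists (c, s).
have op2K f : op2 f #<= [set: set K].
  apply: card_le_rangel; apply: (card_leT_pow_fun infK).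
  exact: (card_leT_pow_prod infK powK2 (card_leT_set1 K)).
have [||A [A0 AK Aop]] := @closing_off _ infK X [set x0]
    (fun f => satop f (i 0) `|` (op1 f `|` op2 f)).
- apply: card_le_trans (card_le_rangel (fun=> x0) (card_leT_set1 K)).
  by apply: subset_card_le => _ ->; exists (i 0).
- by move=> f; do !apply: (card_le_pow_setU infK) => //; exact: card_satop.
exists A => //; apply/seteqP; split=> // p _; apply: contrapT => nAp.
have satA : saturated A.
  apply: saturated_stable => x c s Ax.
  by apply: (Aop (fun=> x)) => //; left; exists (c, s).
pose Fam V := exists l b, [/\ forall k, A (b k), V = member l b & ~ V p].
have covA z : closure A z -> exists2 V, Fam V & V z.
  move=> clz; have [B [BA BK clB]] := saturated_tight satA clz.
  have [b0 [Bb0 _]] := clB _ filterT.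
  have [b bB] := card_le_range BK (ex_intro _ b0 Bb0).
  have Ab k : A (b k) by apply: BA; rewrite -bB; exists k.
  (* On [B] the families of [z] and of its representative [x] agree, so [z] is in the closure of
     each [U x k], hence in each [U x k] by regularity. *)
  pose c := [set kj : K * K | U z kj.1 (b kj.2)].
  pose x := pt (b, c).
  have xc : code x b c by apply: (ptP (b, c)); exists z.
  have [[Uo Ureg] _ _ UHx] := UH x.
  have [[Uzo _] Uzz _ _] := UH z.
  have Uxz : (\bigcap_k U x k) z.
    move=> k _; have [k' k'P] := Ureg k; apply: k'P => N Nz.
    have [y [By [Uy Ny]]] : (B `&` (U z k' `&` N)) !=set0.
      by apply: clB; apply: filterI => //; apply: open_nbhs_nbhs; split=> //; exact: Uzz.
    move: By; rewrite -bB => -[j _ jy]; exists y; split => //; rewrite -jy.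
    by apply/xc; rewrite /c /= jy.
  (* Otherwise [p] would be in the closure of [H x], which [op1] has put into [A]. *)
  have [k nUp] : exists k, ~ U x k p.
    apply: contrapT => n; apply: nAp.
    have HA : H x `<=` A.
      by move=> y Hy; apply: (Aop b) => //; right; left; exists c.
    apply: (closureS HA); apply: UHx => k _.
    by apply: contrapT => ?; apply: n; exists k.
  by exists (U x k); [exists (c, k), b|exact: Uxz].
have [V0 FV0 _] : exists2 V, Fam V & V x0.
  by apply: covA; apply: subset_closure; exact: A0.
pose rest (V : K -> set X) := A `&` ~` \bigcup_i V i.
(* A surjection of [K] onto [K + K] merges two families into one, which makes the sets [rest V]
   directed. *)
have [s sT] := infinite_double infK.
have [|||z zP] := @compact_directed [set rest V | V in [set V | forall i, Fam (V i)]].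
- by exists (rest (fun=> V0)), (fun=> V0).
- move=> _ _ [V VF <-] [W WF <-].
  exists (rest (fun k => match s k with inl j => V j | inr j => W j end)).
    by exists (fun k => match s k with inl j => V j | inr j => W j end) => // k /=;
      case: (s k).
  move=> x [Ax nx]; split; split=> // -[j _ jx]; apply: nx.
    by have [k _ kE] : range s (inl j); [rewrite sT|exists k => //; rewrite kE].
  by have [k _ kE] : range s (inr j); [rewrite sT|exists k => //; rewrite kE].
- move=> _ [V VF <-].
  have /choice[l /choice[b bP]] := VF.
  pose f k := b (d k).1 (d k).2.
  have fE j : part f j = b j by apply/funext => k; rewrite /part /f ed.
  have WE : \bigcup_j V j = \bigcup_j member (l j) (part f j).
    by apply: eq_bigcupr => j _; rewrite fE; have [] := bP j.
  (* The union misses [p], so it is not the whole space and [op2] gives a point of [A] outside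
     it. *)
  exists (out (\bigcup_j V j)); split.
    apply: (Aop f); first by move=> k; have [+ _ _] := bP (d k).1; apply.
    by right; right; exists l; rewrite ?WE.
  apply: outP; apply/eqP => VT; have : (\bigcup_j V j) p by rewrite VT.
  by case=> j _; have [_ _] := bP j.
have clz : closure A z.
  have : closure (rest (fun=> V0)) z by apply: zP; exists (fun=> V0).
  by apply: closureS => x [].
(* The open set [V] contains [z], yet [z] is in the closure of a set disjoint from [V]. *)
have [V FV Vz] := covA z clz.
have clV : closure (rest (fun=> V)) z by apply: zP; exists (fun=> V).
have [l [b [_ VE _]]] := FV.
have [|y [[_ nVy] Vy]] := clV V.
  by apply: open_nbhs_nbhs; split=> //; rewrite VE; have [[+ _] _ _ _] := UH (pt (b, l.1)); apply.
by apply: nVy; exists (i 0).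
Qed.

End compactum.

(** * From the cardinal invariants to the bound *)

Lemma tightness_set_type (X : topologicalType) (C A : set X) (K : Type) x :
  [set: tightness (set_type C)] #<= [set: K] -> A `<=` C -> C x ->
  closure A x -> exists B, [/\ B `<=` A, B #<= [set: K] & closure B x].
Proof.
move=> CK AC Cx clx; pose x' : C := SigSub (mem_set Cx).
have clx' : closure (set_val @^-1` A : set C) x'.
  move=> N [_ [[W oW <-] /= Wx] sW].
  have [y [Ay Wy]] := clx W (open_nbhs_nbhs (conj oW Wx)).
  by exists (SigSub (mem_set (AC y Ay))); split => //; exact: sW.
have [_ tC _] := tightnessP (set_type C).
have [B [BA BK clB]] := tC _ _ clx'.
exists (set_val @` B); split.
- by move=> _ [y /BA Ay <-].
- exact: card_le_trans (card_image_le _ _) (card_le_trans BK CK).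
- move=> N Nx; have [|y [By Ny]] := clB (set_val @^-1` N).
    exact: (@initial_continuous C X set_val x').
  by exists (set_val y); split => //; exists y.
Qed.

(** Enumerating the cover and its witnesses by [set K], with repetitions, yields the data assumed
    for saturation; [x0] makes the cover nonempty. *)
Lemma weak_tightness_cover (X : topologicalType) (K : Type) (x0 : X) :
  [set: weak_tightness X] #<= [set: K] ->
  exists (C : set K -> set X) (S : X -> set K -> set K -> X),
  [/\ forall x, exists c, C c x,
      forall c (A : set X) x, A `<=` C c -> C c x -> closure A x ->
        exists B, [/\ B `<=` A, B #<= [set: K] & closure B x],
      forall x c s, C c (S x c s) &
      forall x c, closure (range (S x c)) x].
Proof.
move=> wK; have [_ [CC [CCT CCK CCP]] _] := weak_tightnessP X.
have wK2 := card_leT_set wK.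
have CCx x : exists2 D, CC D & D x by have : [set: X] x by []; rewrite -CCT.
have [D0 CD0 _] := CCx x0.
have [C CE] := card_le_range (card_le_trans CCK wK2) (ex_intro _ D0 CD0).
have CP c : CC (C c) by rewrite -CE; exists c.
have /choice[S SP] : forall xc : X * set K, exists s : set K -> X,
    (forall k, C xc.2 (s k)) /\ closure (range s) xc.1.
  move=> [x c] /=; have [_ clC] := CCP _ (CP c).
  have : [set: X] x by []; rewrite -clC => -[B [BC BK] clB].
  have [b [Bb _]] := clB _ filterT.
  have [s sB] := card_le_range (card_le_trans BK wK2) (ex_intro _ b Bb).
  by exists s; rewrite sB; split => // k; apply: BC; rewrite -sB; exists k.
exists C, (fun x c => S (x, c)); split.
- by move=> x; have [D + Dx] := CCx x; rewrite -CE => -[c _ cD]; exists c; rewrite cD.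
- move=> c A x; apply: tightness_set_type.
  by have [tC _] := CCP _ (CP c); exact: card_le_trans wK.
- by move=> x c s; have [+ _] := SP (x, c); apply.
- by move=> x c; have [_] := SP (x, c).
Qed.

(** Disjoint neighbourhoods of distinct [x] and [y], pulled back by [h x] and [h y], intersect in a
    neighbourhood of the same point [p]. It contains some [V k], so equal codes would give a point
    in both. *)
Lemma homogeneous_card_le (X : topologicalType) (K : Type) (D : set X) :
  infinite_set [set: K] -> hausdorff_space X -> homogeneous X ->
  [set: pi_character X] #<= [set: K] -> D #<= [set: set K] ->
  closure D = setT -> [set: X] #<= [set: set K].
Proof.
move=> infK hX homX piK DK clD.
have [[p]|nX] := pselect (inhabited X); last first.
  suff -> : [set: X] = set0 by exact: card_ge0.
  by apply/seteqP; split=> x; case: nX; constructor.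
have [_ piX _] := pi_characterP X; have [B [[Bo Bp] BK]] := piX p.
have [V0 BV0 _] := Bp _ filterT.
have [V VB] := card_le_range (card_le_trans BK piK) (ex_intro _ V0 BV0).
have VP k : open (V k) /\ V k !=set0 by apply: Bo; rewrite -VB; exists k.
have /choice[h hP] := homX p.
(* The image of [V k] under [h x] is open and nonempty, so it meets [D]; the preimage of a common
   point is recorded. *)
have /choice[d dP] : forall xk : X * K, exists v, V xk.2 v /\ D (h xk.1 v).
  move=> [x k] /=; have [Vo [v Vv]] := VP k.
  have [[hc [g [gh hg gc]]] _] := hP x.
  have : closure D (h x v) by rewrite clD.
  move=> /(_ (g @^-1` V k))[|y [Dy Vy]].
    by apply: gc; rewrite gh; apply: open_nbhs_nbhs.
  by exists (g y); rewrite hg.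
have [k0 _] := infinite_setN0 infK.
have [D0 D0P] : exists y, D y by exists (h p (d (p, k0))); have [] := dP (p, k0).
have [u uD] := card_le_range DK (ex_intro _ D0 D0P).
have /choice[t tP] : forall xk : X * K, exists s, u s = h xk.1 (d xk).
  by move=> xk; have [_] := dP xk; rewrite -uD => -[s _ us]; exists s.
apply: card_le_trans (card_leT_pow_fun infK (card_lexx _)).
apply: (@inj_card_leT _ _ (fun x k => t (x, k))) => x y txy.
apply: contrapT => /eqP xy; move: hX; rewrite open_hausdorff => /(_ x y xy).
move=> [[P Q] /= [/set_mem Px /set_mem Qy] [Po Qo /eqP PQ]].
have [[hxc _] hxp] := hP x; have [[hyc _] hyp] := hP y.
have : nbhs p (h x @^-1` P `&` h y @^-1` Q).
  by apply: filterI; [apply: hxc|apply: hyc];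
    rewrite ?hxp ?hyp; exact: open_nbhs_nbhs.
move=> /Bp[W + WPQ]; rewrite -VB => -[k _ kW].
have dd : h x (d (x, k)) = h y (d (y, k)).
  by rewrite -(tP (x, k)) -(tP (y, k)); congr u; exact: (congr1 (@^~ k) txy).
suff : set0 (h x (d (x, k))) by [].
rewrite -PQ; split.
  by have [] : (h x @^-1` P `&` h y @^-1` Q) (d (x, k));
    [apply: WPQ; rewrite -kW; have [] := dP (x, k)|].
by rewrite dd; have [] : (h x @^-1` P `&` h y @^-1` Q) (d (y, k));
  [apply: WPQ; rewrite -kW; have [] := dP (y, k)|].
Qed.

Theorem corollary3p6 (X : topologicalType)
    (compactX : compact [set: X]) (hausdorffX : hausdorff_space X)
    (homX : homogeneous X) :
  [set: X] #<= [set: set (weak_tightness X * pi_character X)].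
Proof.
have [[x0]|nX] := pselect (inhabited X); last first.
  suff -> : [set: X] = set0 by exact: card_ge0.
  by apply/seteqP; split=> x; case: nX; constructor.
have [infw _ _] := weak_tightnessP X; have [infp _ _] := pi_characterP X.
set K : Type := (weak_tightness X * pi_character X)%type.
have [w0 _] := infinite_setN0 infw; have [p0 _] := infinite_setN0 infp.
have wK : [set: weak_tightness X] #<= [set: K].
  by apply: (@inj_card_leT _ K (fun w => (w, p0))) => x y [].
have pK : [set: pi_character X] #<= [set: K].
  by apply: (@inj_card_leT _ K (fun p => (w0, p))) => x y [].
have infK : infinite_set [set: K] by move=> /(card_le_finite wK).
have [C [S [C_cover C_tight S_sub S_clos]]] := weak_tightness_cover x0 wK.
have [U [A [Ureg [g0 Ug0] AK UA]]] :=
  exists_small_cover infK compactX hausdorffX C_cover C_tight S_sub S_clos x0.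
have [D DK clD] : exists2 D : set X, D #<= [set: set K] & closure D = setT.
  apply: (exists_small_dense infK compactX C_cover C_tight S_sub S_clos) => x.
  have [h [[hc [g [gh hg gc]]] hx]] := homX g0 x.
  (* The homeomorphism taking [g0] to [x] transports the family and the small set found at [g0]. *)
  exists (fun k => g @^-1` U k), (h @` A); split.
  - exact: regular_family_preimage.
  - by move=> k _ /=; rewrite -hx gh; exact: Ug0.
  - exact: card_le_trans (card_image_le _ _) AK.
  - move=> y Uy N /= Ny; have : closure A (g y) by apply: UA.
    move=> /(_ (h @^-1` N))[|a [Aa Na]]; first by apply: hc; rewrite hg.
    by exists (h a); split => //; exists a.
exact: homogeneous_card_le pK DK clD.
Qed.
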